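(* Let $n$ be a positive integer and let $x$ be a nonzero complex number such that $x^m\neq 1$ for every positive integer $m<n$. Let $A=(a_{ij})$ be the $n\times n$ matrix with \[ a_{ij}=(1-\delta_{ij})\left(1-\frac{1}{1-x^{i-j}}\right), \] where $\delta_{ij}=1$ if $i=j$ and $0$ otherwise. Let $k$ be an integer with $0\le k<n$, let $1\le s_1<s_2<\cdots<s_k\le n$, and let $B=(b_{ij})$ be the $(n-k)\times(n-k)$ matrix obtained from $A$ by deleting the rows and the columns with indices $s_1,\dots,s_k$ (indexed by $1,\dots,n-k$). \begin{enumerate} \item If $n-k$ is odd, then \[ \sum_{\substack{\tau\in D(n-k)\\ \operatorname{sign}(\tau)=1}}\prod_{j=1}^{n-k}b_{j\tau(j)}=\sum_{\substack{\tau\in D(n-k)\\ \operatorname{sign}(\tau)=-1}}\prod_{j=1}^{n-k}b_{j\tau(j)}=0. \] \item If $n-k$ is even, then \[ \sum_{\substack{\tau\in D(n-k)\\ \operatorname{sign}(\tau)=(-1)^{\frac{n-k}{2}+1}}}\prod_{j=1}^{n-k}b_{j\tau(j)}=0. \] \end{enumerate}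
   Context: For a positive integer $m$, $D(m)$ denotes the set of all derangements of $\{1,\dots,m\}$, i.e. permutations $\tau$ of $\{1,\dots,m\}$ with $\tau(j)\neq j$ for all $j$; $\operatorname{sign}(\tau)$ is the sign of the permutation $\tau$. *)

(* Defs.v *)
From HB Require Import structures.
From mathcomp Require Import all_boot all_order all_algebra all_fingroup.
From mathcomp Require Import reals complex.

Set Implicit Arguments.
Unset Strict Implicit.
Unset Printing Implicit Defensive.

Import Order.TTheory GRing.Theory Num.Theory.
Local Open Scope ring_scope.
Local Open Scope complex_scope.

Definition derangements (m : nat) : {set 'S_m} :=
  [set t : 'S_m | [forall j, t j != j]].

Definition perm_sign (m : nat) (t : 'S_m) : int := (-1) ^+ odd_perm t.

(* Indices are 0-based; the entries depend only on i - j.  On the diagonal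
   the second factor has no mathematical meaning (it is 1, since 0^-1 = 0),
   but it is multiplied by 0. *)
Definition matrixA (R : realType) (n : nat) (x : R[i]) : 'M[R[i]]_n :=
  \matrix_(i < n, j < n)
    ((1 - (i == j)%:R) * (1 - 1 / (1 - x ^ (i%:Z - j%:Z)))).

Definition strictly_increasing (k n : nat) (s : 'I_k -> 'I_n) : Prop :=
  forall p q : 'I_k, (p < q)%N -> (s p < s q)%N.

Definition kept (k n : nat) (s : 'I_k -> 'I_n) : {set 'I_n} :=
  ~: [set s p | p : 'I_k].

Lemma card_kept (k n : nat) (s : 'I_k -> 'I_n) :
  strictly_increasing s -> #|kept s| = (n - k)%N.
Proof.
move=> hs; have inj_s : injective s.
  move=> p q eq_s; apply: val_inj; case: (ltngtP p q) => // /hs;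
  by rewrite eq_s ltnn.
by rewrite /kept cardsCs setCK card_imset // !card_ord.
Qed.

(* enum_val lists the kept indices in increasing order, so the remaining rows
   and columns keep their relative order. *)
Definition delete_indices (T : Type) (k n : nat) (s : 'I_k -> 'I_n)
    (hs : strictly_increasing s) (A : 'M[T]_n) : 'M[T]_(n - k) :=
  castmx (card_kept hs, card_kept hs)
    (mxsub (@enum_val _ (mem (kept s))) (@enum_val _ (mem (kept s))) A).

(* Main.v *)
Require Import Defs.
From mathcomp Require Import all_boot all_order all_algebra all_fingroup.
From mathcomp Require Import reals complex.
From mathcomp Require Import ring.

Set Implicit Arguments.
Unset Strict Implicit.
Unset Printing Implicit Defensive.

Import Order.TTheory GRing.Theory Num.Theory.
Local Open Scope ring_scope.
Local Open Scope complex_scope.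

(** Writing y_i = x^i, the off-diagonal entries of A are y_i / (y_i - y_j), so
    up to the factor prod y_j one has to sum prod 1 / (y_j - y_(t j)) over the
    permutations t with support S and given sign.  Fix a in S.  Bypassing a in
    its cycle turns t into a permutation u fixing a, of the opposite sign; t is
    recovered from u and c = t^-1 a.  If u moves c, then u has support S \ a,
    and t contributes the weight of u times
      1 / (y_c - y_a) - 1 / (y_(u c) - y_a),
    which sums to 0 over c since u permutes S \ a.  Otherwise (a c) is a
    2-cycle of t, and induction applies to S \ {a, c}, with the opposite sign;
    the base S = 0 only has the even permutation 1. *)

Section SupportSums.
Variables (F : fieldType) (T : finType) (y : T -> F).
Hypothesis y_inj : injective y.
Implicit Types (S : {set T}) (a c : T) (t : {perm T}).

Definition moved t : {set T} := [set j | t j != j].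

Definition weight S t : F := \prod_(j in S) (y j - y (t j))^-1.

Definition signed_sum S (e : bool) : F :=
  \sum_(t : {perm T} | (moved t == S) && (odd_perm t == e)) weight S t.

(** Products act left to right: [tperm a c * t] sends c to a and a to t c. So it inserts a into the
    cycle of c, just after c, and undoes the bypass of a; if t fixes c, it creates the 2-cycle (a
    c). *)
Lemma moved_tpermM a c t :
  t a = a -> c != a -> moved (tperm a c * t)%g = a |: (c |: moved t).
Proof.
move=> ta ca; apply/setP=> j; rewrite !inE permM.
case: (eqVneq j a) => [->|ja] /=.
  by rewrite tpermL -[X in _ != X]ta (inj_eq perm_inj).
case: (eqVneq j c) => [->|jc] /=; first by rewrite tpermR ta eq_sym.
by rewrite tpermD // eq_sym.
Qed.

(** This turns the condition selecting the permutations with a given c into one on the bypassed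
    permutation. *)
Lemma tpermMV_eq a c t : ((tperm a c * t)^-1%g a == c) = (t a == a).
Proof.
by rewrite -(inj_eq (@perm_inj _ (tperm a c * t)%g)) permKV permM tpermR eq_sym.
Qed.

Lemma odd_tpermM a c t :
  c != a -> odd_perm (tperm a c * t)%g = ~~ odd_perm t.
Proof. by move=> ca; rewrite odd_permM odd_tperm eq_sym ca. Qed.

Lemma weight_tpermM S a c t :
  a \in S -> c \in S -> c != a -> t a = a ->
  weight S (tperm a c * t)%g =
    (y a - y (t c))^-1 * (y c - y a)^-1 * weight (S :\ a :\ c) t.
Proof.
move=> aS cS ca ta.
have cSa : c \in S :\ a by rewrite !inE ca.
rewrite /weight (big_setD1 a aS) (big_setD1 c cSa) /= mulrA.
rewrite !permM tpermL tpermR ta; congr (_ * _).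
apply: eq_bigr => j; rewrite !inE => /and3P[jc ja _].
by rewrite permM tpermD // eq_sym.
Qed.

(** Partial fractions: (y_c - y_tc) / ((y_a - y_tc) (y_c - y_a)) is the difference on the right. The
    hypothesis [t c != c] keeps y_c - y_tc nonzero. *)
Lemma weight_insert S a c t :
  a \in S -> c \in S -> c != a -> t a = a -> t c != c ->
  weight S (tperm a c * t)%g =
    weight (S :\ a) t * ((y c - y a)^-1 - (y (t c) - y a)^-1).
Proof.
move=> aS cS ca ta tc.
have cSa : c \in S :\ a by rewrite !inE ca.
rewrite weight_tpermM // [weight (S :\ a) t](big_setD1 c cSa) /=.
rewrite -/(weight (S :\ a :\ c) t).
have d1 : y c - y a != 0 by rewrite subr_eq0 (inj_eq y_inj).
have d2 : y (t c) - y a != 0.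
  by rewrite subr_eq0 (inj_eq y_inj) -[X in _ != X]ta (inj_eq perm_inj).
have d3 : y c - y (t c) != 0 by rewrite subr_eq0 (inj_eq y_inj) eq_sym.
have d4 : y a - y (t c) != 0 by rewrite -opprB oppr_eq0.
by field; rewrite d1 d2 d3 d4.
Qed.

Lemma telescope_sum S a t :
  moved t = S ->
  \sum_(c in S) ((y c - y a)^-1 - (y (t c) - y a)^-1) = 0.
Proof.
move=> tS; rewrite big_split /= sumrN; apply/eqP; rewrite subr_eq0; apply/eqP.
rewrite (reindex_inj (@perm_inj _ t)) /=; apply: eq_bigl => c.
by rewrite -tS !inE (inj_eq perm_inj).
Qed.

Lemma moved_insert_eq S a c t :
  a \in S -> c \in S -> c != a ->
  [&& moved (tperm a c * t)%g == S, t a == a & t c != c]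
  = (moved t == S :\ a).
Proof.
move=> aS cS ca; apply/and3P/eqP => [[/eqP <- /eqP ta tc]|tSa].
  rewrite moved_tpermM //; apply/setP=> j; rewrite !inE.
  case: (eqVneq j a) => [->|ja] /=; first by rewrite ta eqxx.
  by case: (eqVneq j c) => [->|].
have ta : t a = a.
  by apply/eqP; have /setP/(_ a) := tSa; rewrite !inE eqxx /= => /negbFE.
split; rewrite ?ta //; last first.
  by have /setP/(_ c) := tSa; rewrite !inE ca cS.
by rewrite moved_tpermM // tSa setUCA setD1K // (setUidPr _) // sub1set.
Qed.

Lemma moved_2cycle_eq S a c t :
  a \in S -> c \in S -> c != a ->
  [&& moved (tperm a c * t)%g == S, t a == a & t c == c]
  = (moved t == S :\ a :\ c).
Proof.
move=> aS cS ca; apply/and3P/eqP => [[/eqP <- /eqP ta /eqP tc]|tS].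
  rewrite moved_tpermM //; apply/setP=> j; rewrite !inE.
  case: (eqVneq j a) => [->|ja] /=; first by rewrite ta eqxx andbF.
  by case: (eqVneq j c) => [->|] //=; rewrite tc eqxx.
have ta : t a = a.
  by apply/eqP; have /setP/(_ a) := tS; rewrite !inE eqxx andbF => /negbFE.
have tc : t c = c.
  by apply/eqP; have /setP/(_ c) := tS; rewrite !inE eqxx => /negbFE.
split; rewrite ?ta ?tc //.
by rewrite moved_tpermM // tS setD1K ?setD1K // !inE ca.
Qed.

Lemma signed_sum_rec S a e :
  a \in S ->
  signed_sum S e =
    \sum_(c in S :\ a) (y a - y c)^-1 * (y c - y a)^-1
                       * signed_sum (S :\ a :\ c) (~~ e).
Proof.
move=> aS.
(* [G c t] is the contribution of the case where t moves c. Its double sum vanishes by telescoping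
   in c for each fixed t; adding this zero to the right-hand side lets both sides be compared
   separately for each c. *)
pose G c t := weight (S :\ a) t * ((y c - y a)^-1 - (y (t c) - y a)^-1).
have G0 : \sum_(c in S :\ a)
    \sum_(t | (moved t == S :\ a) && (odd_perm t == ~~ e)) G c t = 0.
  rewrite exchange_big /= big1 // => t /andP[/eqP tS _].
  by rewrite -mulr_sumr telescope_sum ?mulr0.
rewrite -[RHS]add0r -[X in _ = X + _]G0 -big_split /=.
rewrite [LHS](partition_big (fun t => t^-1%g a) (mem (S :\ a))) /=; last first.
  move=> t /andP[/eqP tS _]; have ta : t a != a by move: aS; rewrite -tS inE.
  have tVa : t^-1%g a != a.
    by rewrite -(inj_eq (@perm_inj _ t)) permKV eq_sym.
  by rewrite 2!inE tVa -tS inE permKV eq_sym.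
apply: eq_bigr => c; rewrite !inE => /andP[ca cS].
rewrite (reindex_inj (mulgI (tperm a c))) /= (bigID (fun t => t c != c)) /=.
(* Here b stands for [t c != c] or its negation, so that one identity serves both cases. *)
have pE t b : [&& moved (tperm a c * t)%g == S, t a == a & b]
         && (odd_perm t == ~~ e)
  = ((moved (tperm a c * t)%g == S) && (odd_perm (tperm a c * t)%g == e)
      && ((tperm a c * t)^-1%g a == c)) && b.
  rewrite tpermMV_eq odd_tpermM //.
  by case: (moved _ == S) (t a == a) b (odd_perm t) (e) => [] [] [] [] [].
congr (_ + _).
  apply: eq_big => [t|t]; rewrite -pE; first by rewrite moved_insert_eq.
  by case/andP=> /and3P[_ /eqP ta tc] _; rewrite weight_insert.
rewrite mulr_sumr; apply: eq_big => [t|t]; rewrite -pE.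
  by rewrite negbK moved_2cycle_eq.
case/andP=> /and3P[_ /eqP ta]; rewrite negbK => /eqP tc _.
by rewrite weight_tpermM // tc.
Qed.

(** Removing a and c lowers #|S| by two and flips e, so the hypothesis is inherited. For odd #|S|
    the descent ends at a singleton, where the sum over c is empty; for even #|S| it ends at the
    empty set with e true, and the identity is not odd. *)
Lemma signed_sum_eq0 S e :
  odd #|S| || (e != odd #|S|./2) -> signed_sum S e = 0.
Proof.
have [m] := ubnP #|S|; elim: m S e => // m IHm S e.
have [->|[a aS]] := set_0Vmem S.
  rewrite cards0 /= => _ /negbTE e1; apply: big_pred0 => t.
  apply/negP=> /andP[/eqP t0 te]; move: te; suff -> : t = 1%g.
    by rewrite odd_perm1 eq_sym e1.
  apply/permP=> j; rewrite perm1; apply/eqP.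
  by have /setP/(_ j) := t0; rewrite !inE => /negbFE.
move=> Sm He; rewrite (signed_sum_rec _ aS) big1 // => c cSa.
have cardS : #|S| = #|S :\ a :\ c|.+2.
  by rewrite (cardsD1 a) aS (cardsD1 c (S :\ a)) cSa.
rewrite IHm ?mulr0 //.
  by move: Sm; rewrite cardS !ltnS; apply: ltnW.
by move: He; rewrite cardS /= negbK; case: e (odd #|_|./2) => [] [].
Qed.

End SupportSums.

Lemma matrixA_offdiag (R : realType) (n : nat) (x : R[i]) (i j : 'I_n) :
  x != 0 -> x ^+ i != x ^+ j ->
  matrixA n x i j = x ^+ i / (x ^+ i - x ^+ j).
Proof.
move=> x0 xij; have ij : i != j by apply: contraNneq xij => ->.
rewrite mxE (negbTE ij) subr0 mul1r expfzDr // -exprnN -!exprnP.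
have xj0 : x ^+ j != 0 by rewrite expf_neq0.
have d1 : x ^+ i - x ^+ j != 0 by rewrite subr_eq0.
have d2 : x ^+ j - x ^+ i != 0 by rewrite -opprB oppr_eq0.
by field; rewrite xj0 d1 d2.
Qed.

Lemma expf_inj_ord (F : fieldType) (n : nat) (x : F) :
  x != 0 -> (forall m : nat, (0 < m)%N -> (m < n)%N -> x ^+ m != 1) ->
  injective (fun i : 'I_n => x ^+ i).
Proof.
move=> x0 hx; suff H (i j : 'I_n) : (i < j)%N -> x ^+ i != x ^+ j.
  move=> i j eqx; apply: val_inj; case: (ltngtP i j) => // /H;
  by rewrite eqx eqxx.
move=> ij; have := hx (j - i)%N; rewrite subn_gt0 ij => /(_ isT).
rewrite (leq_ltn_trans (leq_subr _ _)) // => /(_ isT); apply: contraNneq => e.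
have xi0 : x ^+ i != 0 by rewrite expf_neq0.
by apply/eqP; apply: (mulfI xi0); rewrite mulr1 -exprD subnKC // ltnW.
Qed.

Lemma derangementsE (m : nat) (t : 'S_m) :
  (t \in derangements m) = (moved t == [set: 'I_m]).
Proof.
rewrite inE; apply/forallP/eqP => [tD|tT j].
  by apply/setP=> j; rewrite !inE tD.
by have /setP/(_ j) := tT; rewrite !inE.
Qed.

Lemma perm_signE (m : nat) (t : 'S_m) (e : bool) :
  (perm_sign t == (-1) ^+ e) = (odd_perm t == e).
Proof. by rewrite /perm_sign; case: (odd_perm t) e => [] []. Qed.

(** An arbitrary injective y makes this apply to principal submatrices directly: deleting indices
    only restricts y. *)
Lemma derangement_sum_eq0 (F : fieldType) (m : nat) (y : 'I_m -> F)
    (B : 'M[F]_m) (e : bool) :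
  injective y -> (forall i j, i != j -> B i j = y i / (y i - y j)) ->
  odd m || (e != odd m./2) ->
  \sum_(t in derangements m | perm_sign t == (-1) ^+ e)
     \prod_(j < m) B j (t j) = 0.
Proof.
move=> y_inj BE He.
transitivity ((\prod_j y j) * signed_sum y [set: 'I_m] e); last first.
  by rewrite signed_sum_eq0 ?mulr0 // cardsT card_ord.
rewrite mulr_sumr; apply: eq_big => [t|t].
  by rewrite derangementsE perm_signE.
rewrite inE => /andP[/forallP tD _].
rewrite /weight [X in _ * X](eq_bigl predT) => [|j]; last by rewrite inE.
by rewrite -big_split; apply: eq_bigr => j _; rewrite BE // eq_sym.
Qed.

Theorem theorem3p1 (R : realType) (n : nat) (hn : (0 < n)%N)
    (x : R[i]) (hx0 : x != 0)
    (hx : forall m : nat, (0 < m)%N -> (m < n)%N -> x ^+ m != 1)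
    (k : nat) (hk : (k < n)%N)
    (s : 'I_k -> 'I_n) (hs : strictly_increasing s) :
  let B : 'M[R[i]]_(n - k) := delete_indices hs (matrixA n x) in
  (odd (n - k) ->
     \sum_(t in derangements (n - k) | perm_sign t == 1)
        \prod_(j < n - k) B j (t j)
     = \sum_(t in derangements (n - k) | perm_sign t == -1)
        \prod_(j < n - k) B j (t j)
     /\ \sum_(t in derangements (n - k) | perm_sign t == -1)
        \prod_(j < n - k) B j (t j) = 0)
  /\
  (~~ odd (n - k) ->
     \sum_(t in derangements (n - k)
            | perm_sign t == (-1) ^+ ((n - k) %/ 2 + 1))
        \prod_(j < n - k) B j (t j) = 0).
Proof.
move=> B.
(* f maps an index of B to the index of A it comes from; only its injectivity is used. *)
pose f i := enum_val (cast_ord (esym (card_kept hs)) i).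
have f_inj : injective f by move=> i j /enum_val_inj/cast_ord_inj.
have x_inj := expf_inj_ord hx0 hx.
have BE i j : i != j -> B i j = x ^+ f i / (x ^+ f i - x ^+ f j).
  move=> ij; rewrite /B /delete_indices castmxE mxE matrixA_offdiag //.
  by rewrite (inj_eq x_inj) (inj_eq f_inj).
have sum0 := derangement_sum_eq0 (inj_comp x_inj f_inj) BE.
split=> [m_odd|m_even].
  by split; rewrite ?(sum0 true) ?m_odd // (sum0 false) ?m_odd.
(* Only the parity of the exponent matters, and the added 1 makes it opposite to that of (n -
   k)/2. *)
rewrite -[(-1) ^+ (_ + 1)]signr_odd sum0 // divn2 addn1 /=.
by case: (odd _./2); rewrite orbT.
Qed.
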